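(* Assume the Generalized Continuum Hypothesis. Let $X$ be an infinite Tychonoff space. Then $C_p^2(X)$ has a point-separating discrete subspace if and only if $s(X^n)\geq iw(X)$ for some natural number $n$.
   Context: $C_p(X)$ is the space of all continuous functions $X\to\mathbb{R}$ with the topology of pointwise convergence, and $C_p^2(X)=C_p(X)\times C_p(X)$. A set $F\subset C_p^2(X)$ is point-separating if for any distinct $x,y\in X$ there is $\langle f_1,f_2\rangle\in F$ with $f_i(x)\neq f_i(y)$ for some $i\in\{1,2\}$. A discrete subspace is a subset that is discrete in its subspace topology; it need not be closed. For a space $Z$, $s(Z)$ (spread) is the supremum of the cardinalities of discrete subspaces of $Z$. $iw(X)$ is the smallest weight of a Tychonoff topology on $X$ contained in (possibly equal to) the topology of $X$. *)

(* Defs.v *)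
From HB Require Import structures.
From mathcomp Require Import all_boot all_order all_algebra.
From mathcomp Require Import all_classical all_reals all_analysis.
Import numFieldNormedType.Exports.

Set Implicit Arguments.
Unset Strict Implicit.
Unset Printing Implicit Defensive.

Local Open Scope classical_set_scope.
Local Open Scope card_scope.

(* No cardinal lies strictly between an infinite cardinal and its power. *)
Definition GCH : Prop :=
  forall T U : Type, infinite_set [set: T] ->
    [set: T] #<= [set: U] -> [set: U] #<= [set: set T] ->
    [set: U] #= [set: T] \/ [set: U] #= [set: set T].

(* Cardinals are represented by sets, compared through [#<=].
   [card_min F] is a member of [F] of least cardinality. Least members exist
   as soon as [F] is nonempty: see [card_minP]. *)
Definition card_min {U : Type} (F : set (set U)) : set U :=
  get [set A | F A /\ forall B, F B -> A #<= B].

(* The supremum of the cardinals [#|A|], [F A]: a least upper bound. Upper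
   bounds may be sought among the subsets of [U], since [setT] is one of them:
   see [card_sup_ub] and [card_sup_le]. *)
Definition card_sup {U : Type} (F : set (set U)) : set U :=
  card_min [set B | forall A, F A -> A #<= B].

Lemma card_le_from_cover {U V : Type} (A : set U) (B : set V) (I : Type)
    (G : set I) (f : I -> U) (g : I -> V) :
  (forall a, A a -> exists2 i, G i & f i = a) ->
  (forall i, G i -> B (g i)) ->
  (forall i j, G i -> G j -> g i = g j -> f i = f j) ->
  A #<= B.
Proof.
move=> cov GB inj; apply/card_leP/injfunPex.
have H (a : A) : exists b : B, exists i, [/\ G i, f i = set_val a & g i = set_val b].
  have [i Gi fi] := cov _ (set_valP a).
  by exists (SigSub (mem_set (GB _ Gi))), i.
have [h hP] := choice H.
exists h => // a b _ _ hab; apply: val_inj.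
have [i [Gi fi gi]] := hP a; have [j [Gj fj gj]] := hP b.
have -> : val a = f i by rewrite fi.
have -> : val b = f j by rewrite fj.
by apply: inj => //; rewrite gi gj hab.
Qed.

Lemma card_minP {U : Type} (F : set (set U)) : F !=set0 ->
  F (card_min F) /\ forall B, F B -> card_min F #<= B.
Proof.
move=> [A0 FA0].
suff [A FA] : exists A, F A /\ forall B, F B -> A #<= B.
  exact: (@getPex _ [set A | F A /\ forall B, F B -> A #<= B] (ex_intro _ A FA)).
have [A0_0|/set0P[u0 Au0]] := eqVneq A0 set0.
  by exists A0; split => // B _; rewrite A0_0 card_ge0.
pose P (G : set (set U -> U)) :=
  (forall g A, G g -> F A -> A (g A)) /\
  (forall g h A, G g -> G h -> F A -> g A = h A -> g = h).
have [G [[Gin Ginj] Gmax]] : exists G, P G /\ forall H, G `<` H -> ~ P H.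
  apply: (@Zorn_bigcup _ P) => C CP Ctot; split.
    by move=> g A [G CG Gg] FA; exact: ((CP _ CG).1 g A Gg FA).
  move=> g h A [G CG Gg] [H CH Hh] FA.
  have [GH|HG] := Ctot _ _ CG CH.
    by exact: ((CP _ CH).2 g h A (GH _ Gg) Hh FA).
  by exact: ((CP _ CG).2 g h A Gg (HG _ Hh) FA).
have [A [FA Acov]] :
    exists A, F A /\ forall a, A a -> exists2 g, G g & g A = a.
  apply: contrapT => nA.
  have new A : exists a, F A -> A a /\ forall g, G g -> g A <> a.
    have [FA|nFA] := pselect (F A); last by exists u0.
    apply: contrapT => na; apply: nA; exists A; split => // a Aa.
    apply: contrapT => ng; apply: na; exists a => _; split => // g Gg gA.
    by apply: ng; exists g.
  have [k kP] := choice new.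
  have nGk : ~ G k by move=> Gk; have [_ /(_ _ Gk)] := kP _ FA0.
  apply: (Gmax (G `|` [set k])).
    by split; [left | move=> sub; apply/nGk/sub; right].
  split.
    by move=> g A [Gg|->] FA; [exact: (Gin g A Gg FA)|have [] := kP _ FA].
  move=> g h A [Gg|->] [Gh|->] FA // gh.
  - exact: (Ginj g h A).
  - by have [_ /(_ _ Gg)] := kP _ FA.
  - by have [_ /(_ _ Gh)] := kP _ FA; rewrite gh.
exists A; split=> // B FB.
apply: (@card_le_from_cover _ _ _ _ _ G (fun g => g A) (fun g => g B)) => //.
  by move=> g Gg; exact: (Gin g B Gg FB).
by move=> g h Gg Gh gh; rewrite (Ginj g h B).
Qed.

Lemma card_le_total {U V : Type} (A : set U) (B : set V) : A #<= B \/ B #<= A.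
Proof.
pose A' : set (U + V) := inl @` A; pose B' : set (U + V) := inr @` B.
have AA' : A' #= A by apply: inj_card_eq => x y _ _ [].
have BB' : B' #= B by apply: inj_card_eq => x y _ _ [].
have [|mE mP] := @card_minP _ [set A'; B']; first by exists A'; left.
have mA : card_min [set A'; B'] #<= A' by apply: mP; left.
have mB : card_min [set A'; B'] #<= B' by apply: mP; right.
case: mE mA mB => -> mA mB.
- by left; rewrite -(card_le_eql AA') -(card_le_eqr BB').
- by right; rewrite -(card_le_eql BB') -(card_le_eqr AA').
Qed.

Lemma card_supP {U : Type} (F : set (set U)) :
  (forall A, F A -> A #<= card_sup F) /\
  forall B : set U, (forall A, F A -> A #<= B) -> card_sup F #<= B.
Proof.
by apply: card_minP; exists setT => A _; exact: card_leT.
Qed.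

Lemma card_sup_ub {U : Type} (F : set (set U)) (A : set U) :
  F A -> A #<= card_sup F.
Proof. exact: (card_supP F).1. Qed.

Lemma card_sup_le {U V : Type} (F : set (set U)) (B : set V) :
  (forall A, F A -> A #<= B) -> card_sup F #<= B.
Proof.
move=> FB; have [BU|UB] := card_le_total B [set: U]; last first.
  by apply: card_le_trans UB; exact: card_leT.
have /card_subP[C CB _] := BU.
rewrite -(card_le_eqr CB); apply: (card_supP F).2 => A FA.
by rewrite (card_le_eqr CB); exact: FB.
Qed.

Definition discrete_subspace {Z : topologicalType} (D : set Z) : Prop :=
  D `<=` isolated D.

Definition spread (Z : topologicalType) : set Z :=
  card_sup [set D : set Z | discrete_subspace D].
Arguments spread : clear implicits.

Definition weight (T : topologicalType) : set (set T) :=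
  card_min [set B : set (set T) | basis B].
Arguments weight : clear implicits.

Lemma weightP (T : topologicalType) :
  basis (weight T : set (set T)) /\
  forall B : set (set T), basis B -> weight T #<= B.
Proof.
apply: card_minP; exists (@open T); split=> // x A.
by rewrite nbhsE => -[U [oU Ux] UA]; exists U.
Qed.

Definition tychonoff_space (T : topologicalType) : Prop :=
  completely_regular_space T /\ hausdorff_space T.

(* The structures [t : Topological X] are the topologies on the carrier of
   [X]; each is compared with the given topology of [X]. *)
Definition coarser_tychonoff (X : topologicalType) (t : Topological X) : Prop :=
  let T := Topological.Pack t in
  tychonoff_space T /\ @open T `<=` @open X.

Definition iw (X : topologicalType) : set (set X) :=
  card_min [set (weight (Topological.Pack t) : set (set X))
    | t in @coarser_tychonoff X].
Arguments iw : clear implicits.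

Lemma iwP (X : topologicalType) : tychonoff_space X ->
  (exists2 t, @coarser_tychonoff X t & weight (Topological.Pack t) = iw X) /\
  forall t, @coarser_tychonoff X t -> iw X #<= weight (Topological.Pack t).
Proof.
move=> tX.
have ctX : coarser_tychonoff (Topological.class X) by case: X tX => S c tX; split.
have /card_minP[iwX iw_le] :
    [set (weight (Topological.Pack t) : set (set X)) | t in @coarser_tychonoff X]
      !=set0.
  by exists (weight (Topological.Pack (Topological.class X))), (Topological.class X).
by split=> [//|t ct]; apply: iw_le; exists t.
Qed.

(* C_p(X): continuous real functions with the topology of pointwise
   convergence, i.e. the one inherited from the product R^X. *)
Definition Cp (R : realType) (X : topologicalType) : topologicalType :=
  initial_topology (id : continuousType X R -> {ptws X -> R}).

Definition point_separating (R : realType) (X : topologicalType)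
    (F : set (Cp R X * Cp R X)) : Prop :=
  forall x y : X, x <> y -> exists2 f : Cp R X * Cp R X, F f &
    (f.1 : continuousType X R) x <> (f.1 : continuousType X R) y \/
    (f.2 : continuousType X R) x <> (f.2 : continuousType X R) y.

(* Main.v *)
Require Import Defs.
From HB Require Import structures.
From mathcomp Require Import all_boot all_order all_algebra.
From mathcomp Require Import all_classical all_reals all_analysis.
From mathcomp Require Import lra.
Import numFieldNormedType.Exports.
Import Order.TTheory GRing.Theory Num.Theory.

(** Write [k] for [iw X]. The heart of the matter is that both sides of the
    equivalence amount to the existence of an infinite discrete subspace of
    size at least [k] in a finite power of [X].

    Such a subspace always yields the required functions
    ([separating_discrete_of_power]). By means of bump functions each of its
    points gives a pair [(f, g)] of functions, and these pairs form a discrete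
    set; this is where two functions are needed, for together they record at
    which coordinate each bump sits. There is room in the construction to
    perturb [f] by a small function. As [k] continuous functions separate the
    points of [X], the pairs together with their perturbations separate them.

    It remains to find the subspace, and there are two cases.

    If [k] is a strong limit, the square of [X] contains a discrete subspace of
    size [k], so both sides hold
    ([strong_limit_power_discrete]). One collects pairs of points [(x, y)], each
    with a function that crosses the level [1/2] from [x] to [y] but not on any
    other pair. As long as fewer than [k] pairs have been chosen, the closure of
    the set of points used has fewer than [k] members by the strong limit
    property, and fewer than [k] functions do not separate points, so another
    pair can be added.

    If [k] is not a strong limit, GCH makes it the power, and the successor, of
    an infinite cardinal [T]. A spread that reaches a successor is attained,
    which gives one direction. For the other, a point-separating set [F] has at
    least [k] members, because a family of infinite cardinality that separates
    points bounds [iw X] ([iw_le]). When [F] is discrete, each member is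
    isolated by rational constraints on its values at finitely many points.
    There are countably many patterns of such constraints, and a power of an
    infinite cardinal is not a countable union of smaller sets
    ([card_powerset_bigcup]), so [k] members share one pattern; exchanging the
    roles of points and functions, their tuples of points form a discrete
    subspace of a finite power of [X] ([power_discrete_of_functions]).

    The counting rests on Hessenberg's theorem ([infinite_pairing]), which is
    proved with Zorn's lemma. *)

Set Implicit Arguments.
Unset Strict Implicit.
Unset Printing Implicit Defensive.

Local Open Scope classical_set_scope.
Local Open Scope card_scope.

(** * Comparing cardinals *)

(** Cardinals are compared below through total functions between the ambient
    types, which is why an inhabitant of the codomain is sometimes asked for. *)
Lemma card_le_surj (T U : Type) (A : set T) (B : set U) (s : U -> T) :
  (forall a, A a -> exists2 b, B b & s b = a) -> A #<= B.
Proof.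
move=> sA; apply: (@card_le_from_cover _ _ _ _ U B s id) => //.
by move=> i j _ _ ->.
Qed.

Lemma card_le_inj (T U : Type) (f : T -> U) :
  injective f -> [set: T] #<= [set: U].
Proof.
move=> fI; apply: (@card_le_from_cover _ _ _ _ T setT id f) => //.
  by move=> a _; exists a.
by move=> i j _ _ /fI.
Qed.

Lemma card_le_exinj (T U : Type) (A : set T) (B : set U) (u0 : U) : A #<= B ->
  exists2 f : T -> U, (forall a, A a -> B (f a)) &
    forall a a', A a -> A a' -> f a = f a' -> a = a'.
Proof.
move=> /card_leP/injfunPex[f _ fI].
pose g a := if pselect (A a) is left Aa then val (f (SigSub (mem_set Aa))) else u0.
exists g => [a Aa|a a' Aa Aa'].
  by rewrite /g; case: pselect => // Aa2; exact: set_valP.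
rewrite /g; case: pselect => // Aa2; case: pselect => // Aa2'.
by move/val_inj/fI; rewrite !in_setT => /(_ isT isT) [].
Qed.

Lemma card_le_exsurj (T U : Type) (A : set T) (B : set U) (t0 : T) : A #<= B ->
  exists s : U -> T, forall a, A a -> exists2 b, B b & s b = a.
Proof.
move=> AB; have [/eqP B0|/set0P[u0 _]] := boolP (B == set0).
  by move: AB; rewrite B0 card_le0 => /eqP ->; exists (fun=> t0).
have [f fB fI] := card_le_exinj u0 AB.
have H u : exists a, forall a', A a' -> f a' = u -> a = a'.
  have [[a [Aa fa]]|na] := pselect (exists a, A a /\ f a = u).
    by exists a => a' Aa' fa'; apply: fI => //; rewrite fa fa'.
  by exists t0 => a' Aa' fa'; case: na; exists a'.
have [s sP] := choice H.
by exists s => a Aa; exists (f a); [exact: fB|exact: sP].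
Qed.

(** * The square of an infinite set *)

(** The graphs of injections [S * S -> S]; the set [S] is recovered from
    the graph as the set of points [a] for which [(a, a)] is in the domain.
    Graphs, unlike functions, are ordered by inclusion, which is the form that
    Zorn's lemma needs. *)
Definition graph_field (T : Type) (G : set (T * T * T)) : set T :=
  [set a | exists c, G (a, a, c)].

Definition pairing_graph (T : Type) (G : set (T * T * T)) : Prop :=
  [/\ forall a b c c', G (a, b, c) -> G (a, b, c') -> c = c',
      forall a b a' b' c, G (a, b, c) -> G (a', b', c) -> a = a' /\ b = b',
      forall a b c, G (a, b, c) ->
        [/\ graph_field G a, graph_field G b & graph_field G c] &
      forall a b, graph_field G a -> graph_field G b -> exists c, G (a, b, c)].

Lemma pairing_graph_bigcup (T : Type) (F : set (set (T * T * T))) :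
  (forall G, F G -> pairing_graph G) -> total_on F subset ->
  pairing_graph (\bigcup_(G in F) G).
Proof.
move=> FP Ftot; set M := \bigcup_(G in F) G.
have join G H : F G -> F H -> exists K, [/\ F K, G `<=` K & H `<=` K].
  by move=> FG FH; have [GH|HG] := Ftot _ _ FG FH; [exists H|exists G]; split.
have sub G : F G -> graph_field G `<=` graph_field M.
  by move=> FG a [c Gc]; exists c, G.
split.
- move=> a b c c' [G FG Gc] [H FH Hc]; have [K [FK GK HK]] := join _ _ FG FH.
  by have [f _ _ _] := FP _ FK; apply: f (GK _ Gc) (HK _ Hc).
- move=> a b a' b' c [G FG Gc] [H FH Hc]; have [K [FK GK HK]] := join _ _ FG FH.
  by have [_ f _ _] := FP _ FK; apply: f (GK _ Gc) (HK _ Hc).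
- move=> a b c [G FG Gc]; have [_ _ /(_ _ _ _ Gc)[? ? ?] _] := FP _ FG.
  by split; apply: sub FG _ _.
- move=> a b [c [G FG Gc]] [d [H FH Hd]]; have [K [FK GK HK]] := join _ _ FG FH.
  have [_ _ _ f] := FP _ FK.
  have [|| e Ke] := f a b; first by exists c; exact: GK.
    by exists d; exact: HK.
  by exists e, K.
Qed.

(** The step that refutes maximality: a copy [j @` S] of the field [S],
    disjoint from it, can be absorbed. The pairs of [S U j @` S] outside
    [S * S] form three blocks, each a copy of [S * S], and all their codes have
    to lie in [j @` S]. There is room for them because [S] contains three
    disjoint copies of [S * S]: a tag [t x y] that names the block is paired
    with the code of the pair. *)
Lemma pairing_graph_extend (T : Type) (M : set (T * T * T)) (p : T -> T -> T)
    (j : T -> T) (t : bool -> bool -> T) :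
  let S := graph_field M in
  pairing_graph M ->
  (forall a b, S a -> S b -> M (a, b, p a b)) ->
  (forall a, S a -> ~ S (j a)) ->
  (forall a b, S a -> S b -> j a = j b -> a = b) ->
  (forall x y, S (t x y)) ->
  (forall x y x' y', x || y -> x' || y' -> t x y = t x' y' -> x = x' /\ y = y') ->
  let E (x : bool) a := if x then j a else a in
  pairing_graph (M `|` [set u | exists x y a b,
    [/\ x || y, S a, S b & u = (E x a, E y b, j (p (t x y) (p a b)))]]).
Proof.
move=> S [Mf Mi Mc Mt] pP jS jI tS tI E; set N := (X in M `|` X).
have pS a b : S a -> S b -> S (p a b).
  by move=> Sa Sb; have [] := Mc _ _ _ (pP _ _ Sa Sb).
have pSS x y a b (Sa : S a) (Sb : S b) := pS _ _ (tS x y) (pS _ _ Sa Sb).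
have pI a b a' b' : S a -> S b -> S a' -> S b' -> p a b = p a' b' ->
    a = a' /\ b = b'.
  move=> Sa Sb Sa' Sb' e; have := pP _ _ Sa' Sb'; rewrite -e.
  exact: Mi (pP _ _ Sa Sb).
have EI x a x' a' : S a -> S a' -> E x a = E x' a' -> x = x' /\ a = a'.
  rewrite /E; case: x; case: x' => //= Sa Sa' e; split=> //.
  - exact: jI.
  - by case: (jS _ Sa); rewrite e.
  - by case: (jS _ Sa); rewrite e.
  - by case: (jS _ Sa'); rewrite -e.
  - by case: (jS _ Sa'); rewrite -e.
have SE x a : S a -> S (E x a) -> x = false.
  by case: x => // Sa /(jS _ Sa).
have fld x a : S a -> graph_field (M `|` N) (E x a).
  move=> Sa; case: x => /=; last by exists (p a a); left; apply: pP.
  by exists (j (p (t true true) (p a a))); right; exists true, true, a, a.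
have fldE a : graph_field (M `|` N) a -> exists x b, S b /\ a = E x b.
  move=> [c [Mac|[x [y [b [d [_ Sb _ [-> _ _]]]]]]]]; last by exists x, b.
  by exists false, a; split=> //; exists c.
have MN x y a b c : x || y -> S a -> S b -> ~ M (E x a, E y b, c).
  by move=> xy Sa Sb /Mc[/(SE _ _ Sa) ex /(SE _ _ Sb) ey _]; rewrite ex ey in xy.
split.
- move=> a b c c' [Mc1|[x [y [a1 [b1 [xy Sa Sb [ea eb ec]]]]]]]
    [Mc2|[x' [y' [a2 [b2 [xy' Sa' Sb' [ea' eb' ec']]]]]]].
  + exact: Mf Mc1 Mc2.
  + by case: (MN _ _ _ _ c xy' Sa' Sb'); rewrite -ea' -eb'.
  + by case: (MN _ _ _ _ c' xy Sa Sb); rewrite -ea -eb.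
  + move: ea'; rewrite ea => /EI[//|//|ex ea'].
    move: eb'; rewrite eb => /EI[//|//|ey eb'].
    by rewrite ec ec' ex ey ea' eb'.
- move=> a b a' b' c [Mc1|[x [y [a1 [b1 [xy Sa Sb [ea eb ec]]]]]]]
    [Mc2|[x' [y' [a2 [b2 [xy' Sa' Sb' [ea' eb' ec']]]]]]].
  + exact: Mi Mc1 Mc2.
  + by have [_ _ Sc] := Mc _ _ _ Mc1; case: (jS _ (pSS x' y' _ _ Sa' Sb'));
      rewrite -ec'.
  + by have [_ _ Sc] := Mc _ _ _ Mc2; case: (jS _ (pSS x y _ _ Sa Sb));
      rewrite -ec.
  + move: ec'; rewrite ec => /jI.
    move=> /(_ (pSS _ _ _ _ Sa Sb) (pSS _ _ _ _ Sa' Sb')).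
    move=> /(pI _ _ _ _ (tS _ _) (pS _ _ Sa Sb) (tS _ _) (pS _ _ Sa' Sb')).
    case=> /(tI _ _ _ _ xy xy')[ex ey] /(pI _ _ _ _ Sa Sb Sa' Sb')[ea2 eb2].
    by rewrite ea ea' eb eb' ex ey ea2 eb2.
- move=> a b c [Mc1|[x [y [a1 [b1 [xy Sa Sb [-> -> ->]]]]]]].
    by have [Sa Sb Sc] := Mc _ _ _ Mc1; split;
      [apply: (fld false)|apply: (fld false)|apply: (fld false)].
  split; [exact: fld|exact: fld|apply: (fld true)].
  exact: pSS.
- move=> _ _ /fldE[x [a [Sa ->]]] /fldE[y [b [Sb ->]]].
  have [xy|] := boolP (x || y).
    by exists (j (p (t x y) (p a b))); right; exists x, y, a, b.
  rewrite negb_or => /andP[/negbTE -> /negbTE ->].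
  by exists (p a b); left; apply: pP.
Qed.

(** Hessenberg's theorem. A maximal pairing on a subset [S], containing a fixed
    countable one so that [S] is infinite, cannot leave out a copy of [S] by the
    previous lemma; so the complement of [S] is no larger than [S], and all of
    [T] embeds into [S]. *)
Lemma infinite_pairing (T : Type) : infinite_set [set: T] ->
  exists p : T * T -> T, injective p.
Proof.
move=> Tinf; have [t0 _] := infinite_setN0 Tinf.
have /(card_le_exinj t0)[i _ iI] := (infiniteP [set: T]).1 Tinf.
pose cc (m n : nat) := i (pickle (m, n)).
pose G0 : set (T * T * T) := [set u | exists m n, u = (i m, i n, cc m n)].
have {}iI m n : i m = i n -> m = n by exact: iI.
have ccI m n m' n' : cc m n = cc m' n' -> m = m' /\ n = n'.
  by move=> /iI/(pcan_inj pickleK)[-> ->].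
have fG0 n : graph_field G0 (i n) by exists (cc n n), n, n.
have G0P : pairing_graph G0.
  split.
  - by move=> a b c c' [m [n [-> -> ->]]] [m' [n' [/iI -> /iI -> ->]]].
  - move=> a b a' b' c [m [n [-> -> ->]]] [m' [n' [-> -> /ccI[-> ->]]]].
    by [].
  - by move=> a b c [m [n [-> -> ->]]]; split; exact: fG0.
  - move=> a b [_ [m [_ [-> _ _]]]] [_ [n [_ [-> _ _]]]].
    by exists (cc m n), m, n.
(* Adding the countable pairing here, and not in the order, keeps the empty
   chain harmless. *)
pose P G := pairing_graph (G0 `|` G).
have [G [GP Gmax]] : exists G, P G /\ forall H, G `<` H -> ~ P H.
  apply: Zorn_bigcup => F FP Ftot.
  pose F' : set (set (T * T * T)) := [set G0] `|` [set G0 `|` X | X in F].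
  suff : pairing_graph (\bigcup_(X in F') X).
    congr pairing_graph; apply/seteqP; split=> u.
      move=> [X [->|[Y FY <-]]]; first by left.
      by move=> [|Yu]; [left|right; exists Y].
    move=> [G0u|[X FX Xu]]; first by exists G0; [left|].
    by exists (G0 `|` X); [right; exists X|right].
  apply: pairing_graph_bigcup => [X [->//|[Y /FP YP <-//]]|X Y].
  move=> [->|[X' FX <-]] [->|[Y' FY <-]].
  - by left.
  - by left=> u; left.
  - by right=> u; left.
  - by have [XY|YX] := Ftot _ _ FX FY; [left|right]; exact: setUS.
set M := G0 `|` G in GP; set S := graph_field M.
have Si n : S (i n).
  by exists (cc n n); left; exists n, n.
have [_ Mi Mc Mt] := GP.
have [p pP] : exists p : T -> T -> T, forall a b, S a -> S b -> M (a, b, p a b).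
  have /choice[p pP] (u : T * T) : exists c, S u.1 -> S u.2 -> M (u, c).
    have [[Sa Sb]|nS] := pselect (S u.1 /\ S u.2); last first.
      by exists t0 => Sa Sb; case: nS.
    by have [c Mc'] := Mt _ _ Sa Sb; exists c; case: u Sa Sb Mc'.
  by exists (fun a b => p (a, b)) => a b; exact: pP (a, b).
have pS a b (Sa : S a) (Sb : S b) : S (p a b).
  by have [] := Mc _ _ _ (pP _ _ Sa Sb).
have pI a b a' b' (Sa : S a) (Sb : S b) (Sa' : S a') (Sb' : S b') :
    p a b = p a' b' -> a = a' /\ b = b'.
  by move=> e; have := pP _ _ Sa' Sb'; rewrite -e; exact: Mi (pP _ _ Sa Sb).
have [SC|CS] := card_le_total S (~` S); last first.
  have [j jS jI] := card_le_exinj (i 0) CS.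
  (* [S] and its complement go into [S] with the distinct tags [i 0] and [i 1]. *)
  pose J a := if pselect (S a) is left _ then p (i 0) a else p (i 1) (j a).
  have JS a : S (J a).
    by rewrite /J; case: pselect => Sa; apply: pS => //; exact: jS.
  have JI : injective J.
    move=> a b; rewrite /J; case: pselect => Sa; case: pselect => Sb e.
    - by have [] := pI _ _ _ _ (Si 0) Sa (Si 0) Sb e.
    - by have [/iI] := pI _ _ _ _ (Si 0) Sa (Si 1) (jS _ Sb) e.
    - by have [/iI] := pI _ _ _ _ (Si 1) (jS _ Sa) (Si 0) Sb e.
    - have [_ e'] := pI _ _ _ _ (Si 1) (jS _ Sa) (Si 1) (jS _ Sb) e.
      exact: jI e'.
  exists (fun u => p (J u.1) (J u.2)) => -[a b] [a' b'] /= e.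
  by have [/JI -> /JI ->] := pI _ _ _ _ (JS _) (JS _) (JS _) (JS _) e.
have [j jS jI] := card_le_exinj t0 SC.
(* Distinct elements of [S] name the blocks; [i 0] names the old one. *)
pose t (x y : bool) := i (x + y.*2).
have tI x y x' y' : x || y -> x' || y' -> t x y = t x' y' -> x = x' /\ y = y'.
  by case: x; case: y; case: x'; case: y' => // _ _ /iI.
have := pairing_graph_extend GP pP jS jI (fun x y => Si _) tI.
cbv zeta; set N := (X in _ `|` X); rewrite /M -setUA => NP; exfalso.
apply: Gmax NP; split=> [u|sub]; first by left.
have : G (j (i 0), i 0, j (p (t true false) (p (i 0) (i 0)))).
  apply: sub; right; exists true, false, (i 0), (i 0).
  by split=> //; exact: Si.
by move=> Gu; have [Sj _ _] := Mc _ _ _ (or_intror Gu); exact: (jS _ (Si 0)).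
Qed.

Lemma card_le_prod_infinite (T U V : Type) : infinite_set [set: T] ->
  [set: U] #<= [set: T] -> [set: V] #<= [set: T] ->
  [set: U * V] #<= [set: T].
Proof.
move=> Tinf UT VT; have [t0 _] := infinite_setN0 Tinf.
have [p pI] := infinite_pairing Tinf.
have [f _ fI] := card_le_exinj t0 UT; have [g _ gI] := card_le_exinj t0 VT.
apply: (@card_le_inj _ _ (fun u => p (f u.1, g u.2))) => -[a b] [a' b'] /= /pI.
by case=> /(fI _ _ I I) -> /(gI _ _ I I) ->.
Qed.

Lemma card_le_sum_infinite (T U V : Type) : infinite_set [set: T] ->
  [set: U] #<= [set: T] -> [set: V] #<= [set: T] ->
  [set: U + V] #<= [set: T].
Proof.
move=> Tinf UT VT; have [t0 _] := infinite_setN0 Tinf.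
have [f _ fI] := card_le_exinj t0 UT; have [g _ gI] := card_le_exinj t0 VT.
apply: card_le_trans (card_le_prod_infinite Tinf _ (card_lexx _)).
  apply: (@card_le_inj _ _
    (fun u => match u with inl a => (false, f a) | inr b => (true, g b) end)).
  by move=> [a|b] [a'|b'] // [] => [/(fI _ _ I I)|/(gI _ _ I I)] ->.
by apply: card_le_trans ((infiniteP _).1 Tinf); exact: countableP.
Qed.

Lemma card_le_seq_infinite (T U : Type) : infinite_set [set: T] ->
  [set: U] #<= [set: T] -> [set: seq U] #<= [set: T].
Proof.
move=> Tinf UT; have [t0 _] := infinite_setN0 Tinf.
have [p pI] := infinite_pairing Tinf.
have [f _ fI] := card_le_exinj t0 UT.
have nT : [set: nat] #<= [set: T] by exact/infiniteP.
apply: card_le_trans (card_le_prod_infinite Tinf nT (card_lexx _)).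
apply: (@card_le_inj _ _
  (fun s => (size s, foldr (fun a c => p (f a, c)) t0 s))).
elim=> [|a s IHs] [|b s'] //= [] ss /pI[/(fI _ _ I I) -> e].
by congr cons; apply: IHs; rewrite ss e.
Qed.

(** * Cofinality of powers *)

(** A power [2 ^ T] has uncountable cofinality, by the diagonal argument of
    Koenig's theorem: as [T] absorbs [C * T], a subset of [T] codes a sequence
    of subsets indexed by [C], and if no piece of the union covered all
    subsets, a sequence whose [c]-th term is missed by the [c]-th piece would
    be missed altogether. *)
Lemma card_powerset_bigcup (T U : Type) (C : countType) (F : C -> set U) :
  infinite_set [set: T] -> [set: set T] #<= \bigcup_c F c ->
  exists c, [set: set T] #<= F c.
Proof.
move=> Tinf /(card_le_exsurj (set0 : set T))[s sP]; apply: contrapT => nF.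
have [t0 _] := infinite_setN0 Tinf.
have CT : [set: C * T] #<= [set: T].
  apply: card_le_prod_infinite => //.
  by apply: card_le_trans ((infiniteP _).1 Tinf); exact: countableP.
have [p _ pI] := card_le_exinj t0 CT.
have /choice[v vP] (c : C) : exists V : set T,
    forall u, F c u -> [set t | s u (p (c, t))] <> V.
  apply: contrapT => nV; apply: nF; exists c.
  apply: (@card_le_surj _ _ _ _ (fun u => [set t | s u (p (c, t))])) => V _.
  apply: contrapT => nu; apply: nV; exists V => u Fu uV.
  by apply: nu; exists u.
have [u [c _ Fcu] su] := sP [set t | exists c t', v c t' /\ t = p (c, t')] I.
apply: (vP c u Fcu); apply/seteqP; split=> t /=; rewrite su.
  by move=> [c' [t' [vt' /(pI _ _ I I) [-> ->]]]].
by move=> vt; exists c, t.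
Qed.

(** * Topologies generated by functions *)

Lemma initial_topology_cvg (S : choiceType) (Y : topologicalType) (h : S -> Y)
    (Phi : set_system S) (s : S) : Filter Phi ->
  h @ Phi --> h s -> Phi --> (s : initial_topology h).
Proof.
move=> FPhi cvg A; rewrite nbhsE => -[_ [[W oW <-] Ws] WA].
by apply: filterS WA _; apply: cvg; exact: open_nbhs_nbhs.
Qed.

Lemma ptws_cvg (I : Type) (Y : topologicalType)
    (Phi : set_system {ptws I -> Y}) (f : {ptws I -> Y}) : Filter Phi ->
  (forall i, (fun g : {ptws I -> Y} => g i) @ Phi --> f i) -> Phi --> f.
Proof.
move=> FPhi cvg; apply/cvg_sup => i.
by apply: (@initial_topology_cvg _ _ (fun g : {ptws I -> Y} => g i)).
Qed.

Lemma ptws_eval_continuous (I : Type) (Y : topologicalType) (i : I) :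
  continuous (fun g : {ptws I -> Y} => g i).
Proof.
move=> f; have /cvg_sup/(_ i) : f --> f by apply: cvg_id.
move=> /cvg_trans h A /(@initial_continuous _ _ (fun g : {ptws I -> Y} => g i) f).
exact: h.
Qed.

Lemma tychonoff_separate (R : realType) (X : topologicalType) (x : X) (C : set X) :
  tychonoff_space X -> closed C -> ~ C x ->
  exists f : X -> R, [/\ continuous f, forall z, (0 <= f z <= 1)%R, f x = 0%R &
    forall z, C z -> f z = 1%R].
Proof.
move=> [cr _] cC nCx; have /(@uniform_separatorP _ R)[f [cf f01 fx fC]] := cr x C cC nCx.
exists f; split=> // [z||z Cz].
- by have := f01 (f z); rewrite /= in_itv /=; apply; exists z.
- by apply: fx; exists x.
- by apply: fC; exists z.
Qed.

Lemma tychonoff_closed1 (X : topologicalType) (x : X) :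
  tychonoff_space X -> closed [set x].
Proof. by move=> [_ /hausdorff_accessible/accessible_closed_set1]; exact. Qed.

(** Finite intersections of subbasic sets, as lists of constraints: the codes
    of basic sets can then be counted. *)
Definition box (Z Y K I : Type) (e : K -> Z -> Y) (b : I -> set Y)
    (w : seq (K * I)) : set Z :=
  foldr (fun q S => e q.1 @^-1` b q.2 `&` S) setT w.

Lemma box_cat (Z Y K I : Type) (e : K -> Z -> Y) (b : I -> set Y) w1 w2 :
  box e b (w1 ++ w2) = box e b w1 `&` box e b w2.
Proof.
by elim: w1 => [|q w1 IH] /=; [rewrite setTI | rewrite IH setIA].
Qed.

(** If convergence in [Z] is tested by the maps [e k], the boxes that contain
    [z] generate a filter that converges to [z]; so they form a base at [z]. *)
Lemma nbhs_box (Z Y : topologicalType) (K I : Type) (e : K -> Z -> Y)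
    (b : I -> set Y) (z : Z) :
  (forall y N, nbhs y N -> exists2 i, b i y & b i `<=` N) ->
  (forall Phi : set_system Z, Filter Phi ->
    (forall k, e k @ Phi --> e k z) -> Phi --> z) ->
  forall A, nbhs z A -> exists2 w, box e b w z & box e b w `<=` A.
Proof.
move=> bP eP; pose Phi := filter_from [set w | box e b w z] (box e b).
apply: eP => [|k N Nz].
  apply: filter_from_filter; first by exists [::].
  by move=> w1 w2 w1z w2z; exists (w1 ++ w2); rewrite /= box_cat.
have [i iz iN] := bP _ _ Nz.
by exists [:: (k, i)] => //= y [/iN].
Qed.

Lemma box_open (Z Y : topologicalType) (K I : Type) (e : K -> Z -> Y)
    (b : I -> set Y) w :
  (forall i, open (b i)) -> (forall k, continuous (e k)) -> open (box e b w).
Proof.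
move=> ob ce; elim: w => [|q w IH] /=; first exact: openT.
by apply: openI => //; apply: open_comp => // y _; exact: ce.
Qed.

Definition rat_itv (R : realType) (q : rat * rat) : set R :=
  `]ratr q.1, ratr q.2[.

Lemma rat_itv_open (R : realType) q : open (@rat_itv R q).
Proof. exact: interval_open. Qed.

Lemma rat_itv_base (R : realType) (y : R) (N : set R) : nbhs y N ->
  exists2 q, rat_itv q y & @rat_itv R q `<=` N.
Proof.
move=> /nbhs_ballP[e /= e0 eN].
have [a /andP[ya ay]] : exists a : rat, (y - e < ratr a < y)%R.
  have [a] := @rat_in_itvoo R (y - e)%R y ltac:(lra).
  by rewrite in_itv /=; exists a.
have [c /andP[yc cy]] : exists a : rat, (y < ratr a < y + e)%R.
  have [c] := @rat_in_itvoo R y (y + e)%R ltac:(lra).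
  by rewrite in_itv /=; exists c.
exists (a, c); first by rewrite /rat_itv /= in_itv /= ay yc.
move=> x; rewrite /rat_itv /= in_itv /= => /andP[ax xc]; apply: eN.
by rewrite /ball /= ltr_norml; lra.
Qed.

(** The topology induced by a separating family is Tychonoff and coarser than
    that of [X], and its base of rational boxes has as many codes as there are
    finite sequences of indices. *)
Lemma iw_le (R : realType) (X : topologicalType) (T : Type) (g : T -> X -> R) :
  tychonoff_space X -> infinite_set [set: T] -> (forall t, continuous (g t)) ->
  (forall x y, x <> y -> exists t, g t x <> g t y) ->
  iw X #<= [set: T].
Proof.
move=> tX Tinf cg gsep.
pose G (x : X) : {ptws T -> R} := fun t => g t x.
pose Z : topologicalType := initial_topology G.
have cG : continuous (G : Z -> {ptws T -> R}) by exact: initial_continuous.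
have ceval t : continuous (g t : Z -> R).
  move=> x; apply: (@continuous_comp Z {ptws T -> R} R G (fun h => h t)).
    exact: cG.
  exact: ptws_eval_continuous.
have cvgZ (x : Z) (Phi : set_system Z) : Filter Phi ->
    (forall t, g t @ Phi --> g t x) -> Phi --> x.
  by move=> FPhi cvg; apply: initial_topology_cvg; exact: ptws_cvg.
have Zcoarse : @coarser_tychonoff X (Topological.class Z).
  split=> /=.
    split; first exact: (@uniform_completely_regular R (initial_topology G)).
    have -> : Topological.Pack (Topological.class Z) = Z by [].
    rewrite open_hausdorff => x y /eqP /gsep[t /eqP txy].
    have hR : hausdorff_space R by exact: Rhausdorff.
    move: hR; rewrite open_hausdorff => /(_ _ _ txy)[[U V] /= [xU yV] [oU oV UV]].
    exists (g t @^-1` U, g t @^-1` V) => /=; first by rewrite !inE in xU yV *.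
    split; [by apply: open_comp => // ? _; exact: ceval
           |by apply: open_comp => // ? _; exact: ceval|].
    apply/eqP/seteqP; split=> // u [Uu Vu].
    by move/eqP/seteqP: UV => [/(_ (g t u)) h _]; apply: h.
  have cid : continuous (id : X -> Z).
    move=> x; apply: cvgZ => t; exact: cg.
  move=> A oA; exact: (open_comp (f := id : X -> Z) (fun x _ => cid x) oA).
have [_ /(_ _ Zcoarse) /card_le_trans] := iwP tX; apply.
have [_ /(_ (range (box (K := T) (g : T -> Z -> R) (@rat_itv R))))] := weightP Z.
move=> /(_ _)/card_le_trans; apply.
  split.
    move=> _ [w _ <-]; apply: box_open => //; exact: rat_itv_open.
  move=> x A /(nbhs_box (@rat_itv_base R) (cvgZ x))[w wx wA].
  by exists (box (K := T) (g : T -> Z -> R) (@rat_itv R) w) => //; split=> //; exists w.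
apply: card_le_trans (card_image_le _ _) _; apply: card_le_seq_infinite => //.
apply: card_le_prod_infinite => //.
by apply: card_le_trans ((infiniteP _).1 Tinf); exact: countableP.
Qed.

(** * Separating families and bump functions *)

(** Conversely, [iw X] functions separate the points of [X]: for each pair of
    members of a small base of a coarser Tychonoff topology, one function that
    is small on the first and large on the second, if there is any. *)
Lemma iw_separating_family (R : realType) (X : topologicalType) (T : Type) :
  tychonoff_space X -> infinite_set [set: T] -> iw X #<= [set: T] ->
  exists h : T -> X -> R, [/\ forall t, continuous (h t),
    forall t x, (0 <= h t x <= 1)%R &
    forall x y, x <> y -> exists t, h t x <> h t y].
Proof.
move=> tX Tinf iwT; have [[c [tZ cZ] cW] _] := iwP tX.
set Z := Topological.Pack c in tZ cZ cW.
have [[_ Wbase] _] := weightP Z.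
have /(card_le_exsurj (set0 : set X))[s sP] : weight Z #<= [set: T] by rewrite cW.
pose good (A B : set X) (f : X -> R) := [/\ continuous f,
  forall x, (0 <= f x <= 1)%R, forall a, A a -> (f a < 1/3)%R &
  forall b, B b -> (2/3 < f b)%R].
have /choice[H HP] (AB : set X * set X) : exists f : X -> R,
    [/\ continuous f, forall x, (0 <= f x <= 1)%R &
     (exists f', good AB.1 AB.2 f') -> good AB.1 AB.2 f].
  have [[f fP]|nf] := pselect (exists f', good AB.1 AB.2 f').
    by exists f; have [] := fP.
  by exists (fun=> 0%R); split=> //; [move=> x; exact: cvg_cst|move=> x; lra].
have [t0 _] := infinite_setN0 Tinf.
have [q qP] := card_le_exsurj (t0, t0)
  (card_le_prod_infinite Tinf (card_lexx [set: T]) (card_lexx [set: T])).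
exists (fun t => H (s (q t).1, s (q t).2)); split=> [t|t x|x y xy].
- by have [] := HP (s (q t).1, s (q t).2).
- by have [_ + _] := HP (s (q t).1, s (q t).2); exact.
have [f [cf f01 fx fy]] :=
  @tychonoff_separate R Z x [set y] tZ (tychonoff_closed1 (x := (y : Z)) tZ) xy.
have Nx : nbhs (x : Z) (f @^-1` [set r | r < 1/3])%R.
  by apply: (cf x); apply: open_nbhs_nbhs; split; [exact: open_lt|rewrite /= fx; lra].
have Ny : nbhs (y : Z) (f @^-1` [set r | 2/3 < r])%R.
  by apply: (cf y); apply: open_nbhs_nbhs; split; [exact: open_gt|rewrite /= fy //; lra].
have [A [WA Ax] Af] := Wbase _ _ Nx; have [B [WB By] Bf] := Wbase _ _ Ny.
have [a _ sa] := sP _ WA; have [b _ sb] := sP _ WB.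
have [t _ qt] := qP (a, b) I.
have [_ _ Hgood] := HP (A, B).
have /Hgood[_ _ HA HB] : exists f', good A B f'.
  exists f; split.
  - by apply/continuousP => O oO; apply: cZ; move: O oO; exact/(@continuousP Z).
  - exact: f01.
  - by move=> z Az; exact: (Af z Az).
  - by move=> z Bz; exact: (Bf z Bz).
exists t; rewrite qt /= sa sb; have := HA _ Ax; have := HB _ By => /=; lra.
Qed.

Lemma ptws_nbhs_box (I : Type) (Y : topologicalType) (d : {ptws I -> Y}) A :
  nbhs d A -> exists2 U : I -> set Y, (forall i, nbhs (d i) (U i)) &
    forall g : {ptws I -> Y}, (forall i, U i (g i)) -> A g.
Proof.
pose Phi : set_system {ptws I -> Y} :=
  filter_from [set U : I -> set Y | forall i, nbhs (d i) (U i)]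
              (fun U => [set g | forall i, U i (g i)]).
have FPhi : Filter Phi.
  apply: filter_from_filter; first by exists (fun=> setT) => i; exact: filterT.
  move=> U V dU dV; exists (fun i => U i `&` V i) => [i|g gUV].
    by apply: filterI; [exact: dU|exact: dV].
  by split=> i; have [] := gUV i.
suff : Phi --> d by apply.
apply: ptws_cvg => i N dN; exists (fun j => [set y | j = i -> N y]) => [j|g].
  have [->|nij] := pselect (j = i); first by apply: filterS dN => y Ny _.
  by apply: (@filterS _ (nbhs (d j)) _ setT); [move=> y _ /nij|exact: filterT].
by move=> /(_ i); exact.
Qed.

(** At each point at most one term of a sum of functions with disjoint supports
    survives. *)
Lemma big_bump (R : realType) (X : choiceType) (s : seq X) (V : X -> set X)
    (u : X -> X -> R) (k : X -> R) (y : X) : uniq s ->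
  (forall x x', x \in s -> x' \in s -> V x y -> V x' y -> x = x') ->
  (forall x, ~ V x y -> u x y = 0%R) ->
  (forall x, x \in s -> ~ V x y) /\ (\sum_(x <- s) k x * u x y = 0)%R \/
  exists x, [/\ x \in s, V x y & (\sum_(z <- s) k z * u z y = k x * u x y)%R].
Proof.
move=> us sV uV.
have [[x [xs Vx]]|nx] := pselect (exists x, x \in s /\ V x y); last first.
  have nV x : x \in s -> ~ V x y by move=> xs Vx; apply: nx; exists x.
  by left; split=> //; apply: big1_seq => x /andP[_ /nV/uV ->]; rewrite mulr0.
right; exists x; split=> //; rewrite (bigD1_seq x) //= big1_seq ?addr0 //.
move=> z /andP[zx zs]; rewrite uV ?mulr0 // => Vz.
by move/eqP: zx; apply; exact: sV.
Qed.

(** The set of indices at which the tuple takes the value [x]. It tells the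
    distinct values of [d] apart, and it determines which coordinates they
    occupy, so tuples with repeated coordinates are treated like all others. *)
Definition coincidence (X : eqType) (n : nat) (d : 'I_n -> X) (x : X) : {set 'I_n} :=
  [set j | d j == x]%SET.

(** Two functions are needed because the value of one bump at a point between
    [0] and its peak would confuse two coordinates. With peaks [c + 1] for one
    function and [N - c] for the other, a large value of the first forces a
    code at least [r], a large value of the second a code at most [r]. *)
Lemma coded_bumps (R : realType) (X : topologicalType) (n : nat)
    (d : 'I_n -> X) (U : 'I_n -> set X) :
  tychonoff_space X -> (forall i, nbhs (d i) (U i)) ->
  let N : nat := #|{set 'I_n}| in
  let c x : nat := enum_rank (coincidence d x) in
  exists p : continuousType X R * continuousType X R,
    (forall i, p.1 (d i) = (c (d i)).+1%:R /\ p.2 (d i) = (N - c (d i))%:R)%R /\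
    forall y (r : nat), (r < N)%N ->
      (r.+1%:R - 1/2 < p.1 y)%R -> ((N - r)%:R - 1/2 < p.2 y)%R ->
      exists i, c (d i) = r /\ forall j, d j = d i -> U j y.
Proof.
move=> tX dU N c; have [_ hX] := tX.
have /choice[W WP] (xy : X * X) : exists AB : set X * set X, xy.1 <> xy.2 ->
    [/\ nbhs xy.1 AB.1, nbhs xy.2 AB.2 & AB.1 `&` AB.2 = set0].
  have [xy12|/eqP xy12] := pselect (xy.1 = xy.2); first by exists (set0, set0).
  have := hX; rewrite open_hausdorff => /(_ _ _ xy12)[[A B] /= [xA yB] [oA oB /eqP AB]].
  exists (A, B) => _ /=; rewrite !inE in xA yB.
  by split=> //; exact: open_nbhs_nbhs.
(* These neighbourhoods depend on the values of [d] only, not on the indices,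
   and are disjoint for distinct values. *)
pose V x := [set y | forall j, if d j == x then U j y else
  (W (x, d j)).1 y /\ (W (d j, x)).2 y].
have VP i : nbhs (d i) (V (d i)).
  apply: filter_forall => j; case: eqP => [<-|ji]; first exact: dU.
  have [Wi _ _] := WP (d i, d j) (nesym ji); have [_ Wj _] := WP (d j, d i) ji.
  exact: filterI Wi Wj.
have Vdisj i j y : V (d i) y -> V (d j) y -> d i = d j.
  move=> Viy Vjy; apply: contrapT => ij.
  have := Viy j; case: eqP => [/esym//|_ [Wy _]].
  have := Vjy i; case: eqP => [//|_ [_ Wy']].
  by have [_ _ /seteqP[/(_ y) h _]] := WP (d i, d j) ij; apply: h.
have /choice[u uP] (x : X) : exists u : X -> R, [/\ continuous u,
    forall y, (0 <= u y <= 1)%R, nbhs x (V x) -> u x = 1%R &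
    nbhs x (V x) -> forall y, ~ V x y -> u y = 0%R].
  have [nV|nV] := pselect (nbhs x (V x)); last first.
    exists (fun=> 0%R); split=> //; [move=> ?; exact: cvg_cst|move=> _; lra].
  have [||f [cf f01 fx fV]] := @tychonoff_separate R X x (~` (V x)°) tX.
  - by apply: open_closedC; exact: open_interior.
  - by apply; exact: nbhs_singleton (nbhs_interior nV).
  exists (fun y => 1 - f y)%R; split=> [y|y|_|_ y nVy].
  - by apply: cvgB; [exact: cvg_cst|exact: cf].
  - by have := f01 y; lra.
  - by rewrite fx subr0.
  - by rewrite fV ?subrr // => /interior_subset.
pose s := undup [seq d i | i <- enum 'I_n].
have sd x : x \in s -> exists i, x = d i.
  by rewrite mem_undup => /mapP[i _ ->]; exists i.
have ds i : d i \in s by rewrite mem_undup map_f // mem_enum.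
pose F (k : X -> R) y := (\sum_(x <- s) k x * u x y)%R.
have cF k : continuous (F k).
  apply: continuous_big => [|x _ y]; first exact: add_continuous.
  by apply: cvgM; [exact: cvg_cst|have [cu _ _ _] := uP x; exact: cu].
have FP k y : (forall x, x \in s -> ~ V x y) /\ F k y = 0%R \/
    exists i, V (d i) y /\ F k y = (k (d i) * u (d i) y)%R.
  have [|||] := @big_bump R X s (fun x y => x \in s /\ V x y)
    (fun x y => if x \in s then u x y else 0%R) k y (undup_uniq _).
  - by move=> _ _ /sd[i ->] /sd[j ->] [_ Vi] [_ Vj]; exact: Vdisj Vi Vj.
  - move=> x nV; case: ifPn => // xs; have [i xi] := sd _ xs.
    have [_ _ _ h] := uP x; apply: h; first by rewrite xi.
    by move=> Vx; apply: nV.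
  - move=> [nV F0]; left; split=> [x xs Vx|]; first by case: (nV x xs).
    by rewrite -F0; apply: eq_big_seq => x ->.
  - move=> [x [xs [_ Vx] Fx]]; right; have [i xi] := sd _ xs.
    exists i; rewrite -xi; split=> //; move: Fx; rewrite xs => <-.
    by apply: eq_big_seq => z ->.
have Fd k i : F k (d i) = k (d i).
  have Vi := nbhs_singleton (VP i).
  have [[/(_ _ (ds i))//]|[j [Vj ->]]] := FP k (d i).
  rewrite (Vdisj _ _ _ Vi Vj); have [_ _ -> //] := uP (d j).
  by rewrite mulr1.
pose f1 := mkcts (cF (fun x => (c x).+1%:R)%R).
pose f2 := mkcts (cF (fun x => (N - c x)%:R)%R).
exists ([the continuousType X R of f1], [the continuousType X R of f2]).
split=> [i|y r rN /=]; first by rewrite /= /f1 /f2 /mkcts !Fd.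
rewrite /f1 /f2 /mkcts.
have [[_ ->]|[i [Vi ->]]] := FP (fun x => (c x).+1%:R)%R y.
  have : (1 <= r.+1%:R :> R)%R by rewrite ler1n.
  by lra.
have [[nV _]|[j [Vj ->]]] := FP (fun x => (N - c x)%:R)%R y.
  by case: (nV _ (ds i)).
rewrite -(Vdisj _ _ _ Vi Vj); have [_ /(_ y) u01 _ _] := uP (d i).
set a := u _ _ in u01 *; move=> h1 h2.
exists i; split; last first.
  by move=> k ki; have := Vi k; rewrite ki eqxx.
have le_r : (r <= c (d i))%N.
  rewrite leqNgt; apply/negP => cr.
  have : ((c (d i)).+1%:R <= r%:R :> R)%R by rewrite ler_nat.
  have : (0 <= (c (d i)).+1%:R :> R)%R by [].
  have : (r%:R + 1 = r.+1%:R :> R)%R by rewrite natr1.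
  nra.
have ge_r : (c (d i) <= r)%N.
  rewrite leqNgt; apply/negP => cr.
  have : ((N - c (d i)).+1%:R <= (N - r)%:R :> R)%R.
    by rewrite ler_nat ltn_sub2l.
  have : (0 <= (N - c (d i))%:R :> R)%R by [].
  have : ((N - c (d i))%:R + 1 = (N - c (d i)).+1%:R :> R)%R by rewrite natr1.
  nra.
by apply/eqP; rewrite eqn_leq le_r ge_r.
Qed.

(** * From discrete sets of tuples to discrete sets of functions *)

Lemma discrete_subspaceP (Z : topologicalType) (D : set Z) :
  discrete_subspace D <->
  forall z, D z -> exists2 V, nbhs z V & forall y, D y -> V y -> y = z.
Proof.
split=> [dD z /dD[_ [V zV VD]]|dD z Dz].
  by exists V => // y Dy Vy; have : (V `&` D) y by []; rewrite VD.
have [V zV VD] := dD z Dz; split; first exact: mem_set.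
exists V => //; apply/seteqP; split=> [y [Vy Dy]|_ ->]; first exact: VD.
by split=> //; exact: nbhs_singleton.
Qed.

(** One family of real functions for both components, so that [nbhs_box]
    applies to the product. *)
Definition Cp2_eval (R : realType) (X : topologicalType) (k : bool * X)
  (p : Cp R X * Cp R X) : R :=
  ((if k.1 then p.1 else p.2) : continuousType X R) k.2.

Lemma Cp2_eval_continuous (R : realType) (X : topologicalType) (k : bool * X) :
  continuous (@Cp2_eval R X k).
Proof.
have cev : continuous (fun f : Cp R X => (f : continuousType X R) k.2).
  move=> f; apply: (@continuous_comp (Cp R X) {ptws X -> R} R
    (id : continuousType X R -> {ptws X -> R}) (fun g => g k.2)).
    exact: initial_continuous.
  exact: ptws_eval_continuous.
move=> p; rewrite /Cp2_eval; case: k.1.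
  apply: (@continuous_comp _ (Cp R X) R fst
    (fun f : Cp R X => (f : continuousType X R) k.2)); [exact: cvg_fst|exact: cev].
apply: (@continuous_comp _ (Cp R X) R snd
  (fun f : Cp R X => (f : continuousType X R) k.2)); [exact: cvg_snd|exact: cev].
Qed.

Lemma Cp2_cvg (R : realType) (X : topologicalType)
    (Phi : set_system (Cp R X * Cp R X)) p : Filter Phi ->
  (forall k, Cp2_eval k @ Phi --> Cp2_eval k p) -> Phi --> p.
Proof.
move=> FPhi cvg; have h (b : bool) : (fun q : Cp R X * Cp R X =>
    if b then q.1 else q.2) @ Phi --> (if b then p.1 else p.2).
  apply: (@initial_topology_cvg _ _ (id : continuousType X R -> {ptws X -> R})).
  by apply: ptws_cvg => x; exact: (cvg (b, x)).
move=> A pA; have : filter_prod (nbhs p.1) (nbhs p.2) A by exact: pA.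
move=> /(cvg_pair (h true) (h false)) hA.
by apply: (@filterS _ Phi FPhi _ _ _ hA) => -[].
Qed.

(** For a point [t] of the discrete set, let [(f, g)] be the bumps coded by
    [t]. If the bumps of [e] are large in the way prescribed by [t] at all
    coordinates of [t], then [t] lies in the box of [e], so [e = t]; hence
    these pairs form a discrete set, with room for errors less than [1/4]. Use
    that room to add to [f] a small function [k t] that runs through a
    separating family: the pairs [(f, g)] and [(f + k t, g)] together are still
    discrete, and where [f] fails to separate two points that [k t] separates,
    [f + k t] separates them. *)
Lemma separating_discrete_of_power (R : realType) (X : topologicalType)
    (n : nat) (D : set {ptws 'I_n -> X}) (x0 : X) :
  tychonoff_space X -> discrete_subspace D -> infinite_set D -> iw X #<= D ->
  exists F : set (Cp R X * Cp R X), point_separating F /\ discrete_subspace F.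
Proof.
move=> tX /discrete_subspaceP dD Dinf iwD.
have Tinf : infinite_set [set: D] by rewrite (eq_finite_set (card_setT D)).
have [h [ch h01 hsep]] : exists h : D -> X -> R, [/\ forall t, continuous (h t),
    forall t x, (0 <= h t x <= 1)%R &
    forall x y, x <> y -> exists t, h t x <> h t y].
  apply: iw_separating_family => //.
  by rewrite (card_le_eqr (card_setT D)).
have /choice[U UP] (t : D) : exists U : 'I_n -> set X,
    (forall i, nbhs (val t i) (U i)) /\
    forall e : D, (forall i, U i (val e i)) -> e = t.
  have [V tV VD] := dD _ (set_valP t); have [U tU UV] := ptws_nbhs_box tV.
  exists U; split=> // e eU; apply: val_inj; apply: VD; first exact: set_valP.
  exact: UV.
pose N : nat := #|{set 'I_n}|.
pose c (t : D) x : nat := enum_rank (coincidence (val t) x).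
have /choice[p pP] (t : D) := coded_bumps R tX (UP t).1.
have cN t x : (c t x < N)%N by exact: ltn_ord.
have key t e :
    (forall i, (c t (val t i)).+1%:R - 1/2 < (p e).1 (val t i) /\
      (N - c t (val t i))%:R - 1/2 < (p e).2 (val t i))%R -> e = t.
  move=> et; apply/esym/(UP e).2 => i.
  have [e1 e2] := et i; have [_ /(_ _ _ (cN t _) e1 e2)[i' [ci Ui]]] := pP e.
  have /setP/(_ i) : coincidence (val e) (val e i') = coincidence (val t) (val t i).
    by apply/enum_rank_inj/val_inj.
  by rewrite !inE eqxx => /eqP ei; apply: Ui.
(* Positive, so that the values at [x0] tell [P t] from [Q t]. *)
pose k t x := ((1 + h t x) / 16)%R.
have k01 t x : (0 < k t x <= 1/8)%R by have := h01 t x; rewrite /k; lra.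
have cq t : continuous (fun x => (p t).1 x + k t x)%R.
  move=> x; apply: cvgD; first exact: cts_fun.
  apply: cvgM; last exact: cvg_cst.
  by apply: cvgD; [exact: cvg_cst|exact: ch].
pose pert t : continuousType X R := [the continuousType X R of mkcts (cq t)].
pose P t : Cp R X * Cp R X := p t.
pose Q t : Cp R X * Cp R X := (pert t, (p t).2).
pose Oi t i : set (Cp R X * Cp R X) :=
  Cp2_eval (true, val t i) @^-1` [set r | (c t (val t i)).+1%:R - 1/4 < r]%R `&`
  Cp2_eval (false, val t i) @^-1` [set r | (N - c t (val t i))%:R - 1/4 < r]%R.
(* [O t] isolates the pair [P t], [Q t] from the rest of the family. *)
pose O t : set (Cp R X * Cp R X) := [set q | forall i, Oi t i q].
have PO t : O t (P t).
  by move=> i; have [/(_ i)[e1 e2] _] := pP t; rewrite /Oi /Cp2_eval /P /= e1 e2;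
    split=> /=; lra.
have QO t : O t (Q t).
  move=> i; have [/(_ i)[e1 e2] _] := pP t.
  rewrite /Oi /Cp2_eval /= /mkcts e1 e2; have := k01 t (val t i); split=> /=; lra.
have Oop t q : O t q -> nbhs q (O t).
  move=> Oq; apply: (@filter_forall _ _ (Oi t) (nbhs q)) => i; have [qi1 qi2] := Oq i.
  apply: filterI; apply: Cp2_eval_continuous; apply: open_nbhs_nbhs.
    by split; [exact: open_gt|].
  by split; [exact: open_gt|].
pose F := range P `|` range Q.
have FO t q : F q -> O t q -> q = P t \/ q = Q t.
  move=> [[e _ <-]|[e _ <-]] Oe; [left|right]; congr (_ _); apply: key => i.
    by have [] := Oe i; rewrite /Cp2_eval /P /= => *; split; lra.
  have [] := Oe i; rewrite /Cp2_eval /Q /= /mkcts => *.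
  by have := k01 e (val t i) => ?; split; lra.
exists F; split.
  move=> x y /hsep[t hxy].
  have [pxy|pxy] := pselect ((p t).1 x = (p t).1 y); last first.
    by exists (P t); [left; exists t|left].
  exists (Q t); first by right; exists t.
  by left; rewrite /Q /= /mkcts pxy /k => hh; apply: hxy; lra.
have Cp2op k' (A : set R) q : open A -> A (Cp2_eval k' q) ->
    nbhs q (@Cp2_eval R X k' @^-1` A).
  by move=> oA Aq; apply: Cp2_eval_continuous; exact: open_nbhs_nbhs.
apply/discrete_subspaceP => q [[t _ <-]|[t _ <-]].
  exists (O t `&` (Cp2_eval (true, x0) @^-1` [set z | z < (p t).1 x0 + k t x0]%R)).
    apply: filterI; first exact: Oop.
    by apply: Cp2op; [exact: open_lt|rewrite /Cp2_eval /=; have := k01 t x0; lra].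
  move=> r Fr [/(FO _ _ Fr)[//|->]].
  by rewrite /Cp2_eval /= /mkcts ltxx.
exists (O t `&` (Cp2_eval (true, x0) @^-1` [set r | (p t).1 x0 < r]%R)).
  apply: filterI; first exact: Oop.
  by apply: Cp2op; [exact: open_gt|rewrite /Cp2_eval /= /mkcts; have := k01 t x0; lra].
move=> r Fr [/(FO _ _ Fr)[->|//]].
by rewrite /Cp2_eval /= ltxx.
Qed.

(** * From discrete sets of functions to discrete sets of tuples *)

Lemma boxP (Z Y K I : Type) (e : K -> Z -> Y) (b : I -> set Y) (q0 : K * I) w z :
  box e b w z <->
  forall i, (i < size w)%N -> b (nth q0 w i).2 (e (nth q0 w i).1 z).
Proof.
elim: w => [//|q w IH] /=; split=> [[qz /IH wz] [|i]//|wz]; first exact: wz.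
by split; [exact: (wz 0%N)|apply/IH => i; exact: (wz i.+1)].
Qed.

(** Each member of a discrete set of pairs of functions is isolated by finitely
    many rational constraints on its values at finitely many points. There are
    only countably many patterns of constraints, so by
    [card_powerset_bigcup] a subset of full size uses a single pattern. The
    relation between functions [f] and tuples [y] that says that [f] satisfies
    the constraints of the pattern at [y] is open in [y]; so the tuples that
    isolate the functions are isolated by the functions. *)
Lemma power_discrete_of_functions (R : realType) (X : topologicalType)
    (T : Type) (F : set (Cp R X * Cp R X)) (x0 : X) :
  infinite_set [set: T] -> discrete_subspace F -> [set: set T] #<= F ->
  exists n, exists2 D : set {ptws 'I_n -> X},
    discrete_subspace D & [set: set T] #<= D.
Proof.
move=> Tinf /discrete_subspaceP dF TF.
have /choice[w wP] (f : Cp R X * Cp R X) : exists w : seq ((bool * X) * (rat * rat)),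
    F f -> box (@Cp2_eval R X) (@rat_itv R) w f /\
      forall g, F g -> box (@Cp2_eval R X) (@rat_itv R) w g -> g = f.
  have [Ff|nFf] := pselect (F f); last by exists [::].
  have [V fV VF] := dF _ Ff.
  have [w wf wV] := nbhs_box (@rat_itv_base R) (fun Phi => @Cp2_cvg R X Phi f) fV.
  by exists w => _; split=> // g Fg /wV; exact: VF.
pose code f := [seq (q.1.1, q.2) | q <- w f].
pose Fc c := [set f | F f /\ code f = c].
have [c Tc] : exists c, [set: set T] #<= Fc c.
  apply: card_powerset_bigcup => //; apply: card_le_trans TF _.
  by apply: subset_card_le => f Ff; exists (code f).
pose q0 := ((true, x0), (0%Q, 0%Q)).
pose pts f : {ptws 'I_(size c) -> X} := fun i => (nth q0 (w f) i).1.2.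
have sz f : Fc c f -> size (w f) = size c by move=> [_ <-]; rewrite size_map.
pose cn i := nth (true, (0%Q, 0%Q)) c i.
have nthw f (i : 'I_(size c)) : Fc c f ->
    nth q0 (w f) i = ((cn i).1, pts f i, (cn i).2).
  move=> Ff; have : cn i = ((nth q0 (w f) i).1.1, (nth q0 (w f) i).2).
    have : (i < size (w f))%N by rewrite sz.
    by move: (nat_of_ord i) => j jw; rewrite /cn -Ff.2 (nth_map q0).
  by rewrite /pts => ->; case: (nth _ _ _) => -[].
pose Vi (f : Cp R X * Cp R X) (i : 'I_(size c)) : set {ptws 'I_(size c) -> X} :=
  [set y : {ptws 'I_(size c) -> X} | rat_itv (cn i).2 (Cp2_eval ((cn i).1, y i) f)].
pose V f : set {ptws 'I_(size c) -> X} := [set y | forall i, Vi f i y].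
have Vpts f g : Fc c g -> V f (pts g) <-> box (@Cp2_eval R X) (@rat_itv R) (w g) f.
  move=> Fg; rewrite (boxP _ _ q0) sz //; split=> [Vg i ic|wg i].
    by have := Vg (Ordinal ic); rewrite (nthw _ (Ordinal ic) Fg).
  by have := wg i (ltn_ord i); rewrite nthw.
have Vsep f g : Fc c f -> Fc c g -> V f (pts g) -> f = g.
  move=> Ff Fg /(Vpts _ _ Fg); have [Fg' _] := Fg; have [Ff' _] := Ff.
  by have [_ +] := wP _ Fg'; apply.
have Vself f : Fc c f -> V f (pts f).
  by move=> Ff; apply/(Vpts _ _ Ff); have [/wP[]] := Ff.
exists (size c), (pts @` Fc c).
  apply/discrete_subspaceP => _ [f Ff <-]; exists (V f); last first.
    by move=> _ [g Fg <-] /(Vsep _ _ Ff Fg) ->.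
  apply: (@filter_forall _ _ (Vi f) (nbhs (pts f))) => i.
  have cfi : continuous (fun y : {ptws 'I_(size c) -> X} => Cp2_eval ((cn i).1, y i) f).
    move=> y; apply: (@continuous_comp {ptws 'I_(size c) -> X} X R (fun y => y i)
      (fun x => Cp2_eval ((cn i).1, x) f)); first exact: ptws_eval_continuous.
    by rewrite /Cp2_eval /=; case: (cn i).1; exact: cts_fun.
  apply: cfi; apply: open_nbhs_nbhs; split; first exact: rat_itv_open.
  exact: Vself.
apply: card_le_trans Tc _.
apply: (@card_le_from_cover _ _ _ _ _ (Fc c) id pts) => [f Ff|f Ff|f g Ff Fg fg].
- by exists f.
- by exists f.
- by apply: Vsep => //; rewrite -fg; exact: Vself.
Qed.

Lemma iw_le_index (R : realType) (X : topologicalType) (J T : Type)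
    (g : J -> X -> R) :
  tychonoff_space X -> infinite_set [set: T] -> [set: J] #<= [set: T] ->
  (forall j, continuous (g j)) ->
  (forall x y, x <> y -> exists j, g j x <> g j y) ->
  iw X #<= [set: T].
Proof.
move=> tX Tinf JT cg gsep.
apply: card_le_trans (card_le_sum_infinite Tinf JT (card_lexx _)).
apply: (@iw_le R X (J + T)
  (fun u => if u is inl j then g j else fun=> 0%R)) => // [|[j|t]|x y /gsep[j gj]].
- move=> Ufin; apply: Tinf; move: Ufin; apply: card_le_finite.
  by apply: (@card_le_inj _ _ inr) => t t' [].
- exact: cg.
- by move=> x; exact: cvg_cst.
- by exists (inl j).
Qed.

Lemma iw_le_point_separating (R : realType) (X : topologicalType) (T : Type)
    (F : set (Cp R X * Cp R X)) :
  tychonoff_space X -> point_separating F -> infinite_set [set: T] ->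
  ~ (iw X #<= [set: T]) -> iw X #<= F.
Proof.
move=> tX sF Tinf nT.
have le (S : Type) : infinite_set [set: S] -> F #<= [set: S] -> iw X #<= [set: S].
  move=> Sinf FS.
  apply: (@iw_le_index R X (bool * F) S (fun u x => Cp2_eval (u.1, x) (val u.2))) => //.
  - apply: card_le_prod_infinite => //; last by rewrite (card_le_eql (card_setT F)).
    by apply: card_le_trans ((infiniteP _).1 Sinf); exact: countableP.
  - by move=> [b f]; rewrite /Cp2_eval /=; case: b => /=; exact: cts_fun.
  - move=> x y /sF[f Ff [fxy|fxy]].
      by exists (true, SigSub (mem_set Ff)).
    by exists (false, SigSub (mem_set Ff)).
have [/(le _ Tinf)//|TF] := card_le_total F [set: T].
rewrite -(card_le_eqr (card_setT F)); apply: le; last first.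
  by rewrite (card_le_eqr (card_setT F)); exact: card_lexx.
rewrite (eq_finite_set (card_setT F)) => Ffin; apply: Tinf.
exact: card_le_finite TF Ffin.
Qed.

(** * Strong limit cardinals *)

Lemma infinite_powerset (T : Type) :
  infinite_set [set: T] -> infinite_set [set: set T].
Proof.
move=> Tinf Sfin; apply: Tinf; move: Sfin; apply: card_le_finite.
apply: (@card_le_inj _ _ (fun t => [set t])) => t t' tt'.
by have : [set t] t by []; rewrite tt'.
Qed.

(** A point of the closure is determined by the subsets of [range s] to whose
    closure it belongs. *)
Lemma card_closure_range (X : topologicalType) (T : Type) (s : T -> X) :
  hausdorff_space X -> closure (range s) #<= [set: set (set T)].
Proof.
move=> hX; pose tr z : set (set T) := [set C | closure (s @` C) z].
apply: (@card_le_from_cover _ _ _ _ _ (closure (range s)) id tr) => //.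
  by move=> z cz; exists z.
move=> x y cx _ xy; apply: contrapT => /eqP nxy.
have := hX; rewrite open_hausdorff => /(_ _ _ nxy)[[A B] /= [xA yB] [oA oB /eqP AB]].
rewrite !inE in xA yB.
have : tr x (s @^-1` A).
  move=> N Nx.
  have [z [[t _ <-] [Nz Az]]] := cx _ (filterI Nx (open_nbhs_nbhs (conj oA xA))).
  by exists (s t); split=> //; exists t.
rewrite xy => /(_ _ (open_nbhs_nbhs (conj oB yB)))[z [[t At <-] Bz]].
by have : (A `&` B) (s t) by []; rewrite AB.
Qed.

Lemma infinite_pigeonhole (X : Type) (C : set X) (n : nat) (S : nat -> X -> Prop) :
  infinite_set C -> exists x y, [/\ C x, C y, x <> y &
    forall i, (i < n)%N -> S i x <-> S i y].
Proof.
move=> Cinf; apply: contrapT => nxy; apply: Cinf.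
pose tr x := [ffun i : 'I_n => `[< S i x >]].
suff : C #<= [set: {ffun 'I_n -> bool}].
  by move=> /card_le_finite; apply; exact: finite_finset.
apply: (@card_le_from_cover _ _ _ _ _ C id tr) => //; first by move=> x Cx; exists x.
move=> x y Cx Cy xy; apply: contrapT => xny; apply: nxy; exists x, y; split=> //.
move=> i ilt; have /ffunP/(_ (Ordinal ilt)) := xy; rewrite !ffunE /=.
by move=> e; split=> h; apply/asboolP; [rewrite -e|rewrite e]; exact/asboolP.
Qed.

(** Triples of two points and a function that crosses the level [1/2] from the
    first point to the second, and from no first to second point of another
    triple. The boxes where the function crosses thus isolate the pairs of
    points in the square of [X]. *)
Definition crossing_family (R : realType) (X : topologicalType)
    (P : set (X * X * (X -> R))) : Prop :=
  (forall p, P p -> continuous p.2 /\ p.2 p.1.1 < 1/2 < p.2 p.1.2)%R /\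
  forall p q, P p -> P q -> p <> q -> ~ (p.2 q.1.1 < 1/2 < p.2 q.1.2)%R.

Lemma max_crossing_family (R : realType) (X : topologicalType) :
  exists P : set (X * X * (X -> R)), crossing_family P /\
    forall Q, P `<` Q -> ~ crossing_family Q.
Proof.
apply: Zorn_bigcup => F FP Ftot; split.
  by move=> p [P FQ Pp]; have [h _] := FP _ FQ; exact: h.
move=> p q [P FP1 Pp] [Q FQ Qq]; have [PQ|QP] := Ftot _ _ FP1 FQ.
  by have [_ h] := FP _ FQ; apply: h => //; exact: PQ.
by have [_ h] := FP _ FP1; apply: h => //; exact: QP.
Qed.

Definition crossing_points (R : realType) (X : topologicalType)
  (P : set (X * X * (X -> R))) : set X :=
  [set x | exists2 p, P p & x = p.1.1 \/ x = p.1.2].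

(** Otherwise the pair [(x, y)] could be added, with a function equal to [1]
    at [y] and at all points used so far: it crosses from none of them, and by
    assumption no old function crosses from [x] to [y]. *)
Lemma max_crossing_cross (R : realType) (X : topologicalType)
    (P : set (X * X * (X -> R))) (x y : X) :
  tychonoff_space X -> crossing_family P ->
  (forall Q, P `<` Q -> ~ crossing_family Q) ->
  x <> y -> ~ closure (crossing_points P) x ->
  exists2 p, P p & (p.2 x < 1/2 < p.2 y)%R.
Proof.
move=> tX [Pc Ps] Pmax xy nx; apply: contrapT => np.
have [||f [cf f01 fx fC]] :=
    @tychonoff_separate R X x (closure (crossing_points P) `|` [set y]) tX.
- by apply: closedU; [exact: closed_closure|exact: tychonoff_closed1].
- by move=> [//|].
have fq q : P q -> f q.1.1 = 1%R.
  by move=> Pq; apply: fC; left; apply: subset_closure; exists q => //; left.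
have fy : f y = 1%R by apply: fC; right.
pose z : X * X * (X -> R) := (x, y, f).
have nz q : P q -> ~ (q.2 x < 1/2 < q.2 y)%R by move=> Pq h; apply: np; exists q.
apply: (Pmax (P `|` [set z])).
  split=> [q|sub]; first by left.
  apply: nx; apply: subset_closure; exists z; last by left.
  by apply: sub; right.
split.
  by move=> q [/Pc//|->]; split=> //=; rewrite fx fy; lra.
move=> p q [Pp|->] [Pq|->] pq //.
- exact: Ps.
- exact: nz.
- by rewrite /= fq //; lra.
Qed.

(** A maximal crossing family [P] is large. Suppose that it has fewer than
    [iw X] members. As [iw X] is a strong limit, the points used by [P] have a
    closure [C] with fewer than [iw X] members, so the functions of [P] together
    with functions that separate the points of [C] are fewer than [iw X] and do
    not separate the points of [X]. Two points that they do not separate cannot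
    both lie in [C], so [max_crossing_cross] applies to them and provides a
    function of [P] that does separate them. *)
Lemma strong_limit_power_discrete (R : realType) (X : topologicalType) :
  tychonoff_space X -> infinite_set [set: X] ->
  (forall T : Type, infinite_set [set: T] ->
     iw X #<= [set: set T] -> iw X #<= [set: T]) ->
  exists D : set {ptws 'I_2 -> X},
    [/\ discrete_subspace D, infinite_set D & iw X #<= D].
Proof.
move=> tX Xinf iwlim; have [_ hX] := tX.
have [P [PP Pmax]] := max_crossing_family R X.
have cross := max_crossing_cross tX PP Pmax.
set A := crossing_points P in cross.
have [Pc Ps] := PP.
have [x0 _] := infinite_setN0 Xinf.
(* A finite [P] fails to distinguish, at the level [1/2], two points that it
   does not use; this covers the case where [iw X] is countable. *)
have Pinf : infinite_set P.
  move=> Pfin; have Afin : finite_set A.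
    have -> : A = [set p.1.1 | p in P] `|` [set p.1.2 | p in P].
      apply/seteqP; split=> [x [p Pp [->|->]]|x [] [p Pp <-]].
      - by left; exists p.
      - by right; exists p.
      - by exists p => //; left.
      - by exists p => //; right.
    by rewrite finite_setU; split; exact: finite_image.
  have cA : closure A = A.
    apply/esym/closure_id.
    by have /accessible_finite_set_closed := hausdorff_accessible hX; apply.
  have [n Pn] := Pfin.
  have [s sP] : exists s : nat -> X * X * (X -> R),
      forall p, P p -> exists2 i, `I_n i & s i = p.
    apply: (card_le_exsurj (x0, x0, fun=> 0%R)).
    by rewrite (card_le_eql Pn) card_lexx.
  have [|x [y [nAx _ xy sxy]]] := @infinite_pigeonhole X (~` A) n
    (fun i x => ((s i).2 x < 1/2)%R).
    by move=> CAfin; apply: Xinf; rewrite -(setUv A) finite_setU.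
  have [|p Pp pxy] := cross x y xy; first by rewrite cA.
  have [i ilt si] := sP _ Pp; have [+ _] := sxy i ilt; rewrite si.
  by move/andP: pxy => [px py] /(_ px); lra.
have Tinf : infinite_set [set: P] by rewrite (eq_finite_set (card_setT P)).
have iwP : iw X #<= P.
  rewrite -(card_le_eqr (card_setT P)); apply: (iwlim _ Tinf).
  apply: (iwlim _ (infinite_powerset Tinf)).
  have [p0 _] := infinite_setN0 Tinf.
  have [q qP] : exists q : P -> bool * P,
      forall u, setT u -> exists2 p, [set: P] p & q p = u.
    apply: (card_le_exsurj (true, p0)); apply: card_le_prod_infinite => //.
    by apply: card_le_trans ((infiniteP _).1 Tinf); exact: countableP.
  pose s p : X := if (q p).1 then (val (q p).2).1.1 else (val (q p).2).1.2.
  have rs : range s = A.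
    apply/seteqP; split=> [_ [p _ <-]|x [p Pp xp]].
      exists (val (q p).2); first exact: set_valP.
      by rewrite /s; case: (q p).1; [left|right].
    have [r _ qr] := qP (`[< x = p.1.1 >], SigSub (mem_set Pp)) I.
    exists r => //; rewrite /s qr /=; case: asboolP => // np.
    by case: xp.
  have clA : closure A #<= [set: set (set P)].
    by rewrite -rs; exact: card_closure_range.
  have Sinf := infinite_powerset (infinite_powerset Tinf).
  have /choice[u uP] (ab : X * X) : exists u : X -> R,
      continuous u /\ (ab.1 <> ab.2 -> u ab.1 <> u ab.2).
    have [ab12|ab12] := pselect (ab.1 = ab.2).
      by exists (fun=> 0%R); split=> //; move=> ?; exact: cvg_cst.
    have [f [cf _ f0 f1]] := @tychonoff_separate R X ab.1 [set ab.2] tX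
      (tychonoff_closed1 tX) ab12.
    by exists f; split=> // _; rewrite f0 f1 //; lra.
  pose C : set X := closure A.
  apply: (@iw_le_index R X (P + C * C) _ (fun j => match j with
    | inl p => (val p).2 | inr ab => u (val ab.1, val ab.2) end)) => //.
  - apply: card_le_sum_infinite => //.
      apply: (@card_le_inj _ _ (fun p => [set [set p]])) => p p' pp'.
      have : [set [set p]] [set p] by []; rewrite pp' => /= e.
      by have : [set p] p by []; rewrite e.
    by apply: card_le_prod_infinite => //; rewrite (card_le_eql (card_setT C)).
  - move=> [p|ab]; first by have [] := Pc _ (set_valP p).
    by have [] := uP (val ab.1, val ab.2).
  - move=> x y xy; apply: contrapT => nj.
    have Psame p : P p -> p.2 x = p.2 y.
      move=> Pp; apply: contrapT => pxy; apply: nj.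
      by exists (inl (SigSub (mem_set Pp))).
    have [Cx|nCx] := pselect (C x); last first.
      by have [p Pp] := cross x y xy nCx; rewrite Psame //; lra.
    have [Cy|nCy] := pselect (C y); last first.
      by have [p Pp] := cross y x (nesym xy) nCy; rewrite Psame //; lra.
    apply: nj; exists (inr (SigSub (mem_set Cx), SigSub (mem_set Cy))).
    by have [_] := uP (x, y); exact.
pose pt (p : X * X * (X -> R)) : {ptws 'I_2 -> X} :=
  fun i => if i == ord0 then p.1.1 else p.1.2.
pose V (p : X * X * (X -> R)) : set {ptws 'I_2 -> X} :=
  (fun g : {ptws 'I_2 -> X} => p.2 (g ord0)) @^-1` [set r | r < 1/2]%R `&`
  (fun g : {ptws 'I_2 -> X} => p.2 (g ord_max)) @^-1` [set r | 1/2 < r]%R.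
have Vpt p q : P p -> P q -> V p (pt q) -> p = q.
  move=> Pp Pq [/= q0 q1]; apply: contrapT => pq; apply: (Ps _ _ Pp Pq pq).
  by apply/andP; split.
have Vself p : P p -> V p (pt p).
  by move=> /Pc[_ /andP[]].
have PD : P #<= pt @` P.
  apply: (@card_le_from_cover _ _ _ _ _ P id pt) => [p Pp|p Pp|p q Pp Pq pq].
  - by exists p.
  - by exists p.
  - by apply: Vpt => //; rewrite -pq; exact: Vself.
exists (pt @` P); split.
- apply/discrete_subspaceP => _ [p Pp <-]; exists (V p); last first.
    by move=> _ [q Pq <-] /(Vpt _ _ Pp Pq) ->.
  have [cp _] := Pc _ Pp.
  have ce (i : 'I_2) : continuous (fun g : {ptws 'I_2 -> X} => p.2 (g i)).
    move=> g; apply: (@continuous_comp {ptws 'I_2 -> X} X R (fun g => g i) p.2).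
      exact: ptws_eval_continuous.
    exact: cp.
  have [V0 V1] := Vself _ Pp.
  apply: filterI; apply: ce; apply: open_nbhs_nbhs.
    by split; [exact: open_lt|].
  by split; [exact: open_gt|].
- by move=> /(card_le_finite PD).
- exact: card_le_trans iwP PD.
Qed.

(** * The equivalence *)

Unset Implicit Arguments.

Theorem theorem2p10 (R : realType) (X : topologicalType) :
  GCH -> tychonoff_space X -> infinite_set [set: X] ->
  (exists F : set (Cp R X * Cp R X),
     point_separating F /\ discrete_subspace F) <->
  (exists n : nat, iw X #<= spread {ptws 'I_n -> X}).
Proof.
move=> gch tX Xinf; have [x0 _] := infinite_setN0 Xinf.
have [iwlim|] := pselect (forall T : Type, infinite_set [set: T] ->
    iw X #<= [set: set T] -> iw X #<= [set: T]).
  have [D [dD Dinf iwD]] := strong_limit_power_discrete R tX Xinf iwlim.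
  split=> _; last exact: (separating_discrete_of_power R x0 tX dD Dinf iwD).
  by exists 2; apply: card_le_trans iwD _; exact: card_sup_ub.
move=> /existsNP[T /not_implyP[Tinf /not_implyP[iwT niwT]]].
have Tiw : [set: T] #<= iw X.
  by have [/niwT|] := card_le_total (iw X) [set: T].
have [Tiw'|iwE] : [set: iw X] #= [set: T] \/ [set: iw X] #= [set: set T].
- apply: gch => //; first by rewrite (card_le_eqr (card_setT _)).
  by rewrite (card_le_eql (card_setT _)).
- by case: niwT; rewrite -(card_le_eql (card_setT _)) (card_le_eql Tiw').
(* Now [iw X] is the power of [T] and, by the continuum hypothesis, its successor. *)
have STiw : [set: set T] #<= iw X.
  by rewrite -(card_le_eqr (card_setT (iw X))) (card_le_eqr iwE).
split.
  move=> [F [sF dF]].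
  have iwF := iw_le_point_separating tX sF Tinf niwT.
  have [n [D dD TD]] :=
    power_discrete_of_functions x0 Tinf dF (card_le_trans STiw iwF).
  exists n; apply: card_le_trans iwT _; apply: card_le_trans TD _.
  exact: card_sup_ub.
move=> [n iwn].
have [D dD iwD] : exists2 D : set {ptws 'I_n -> X}, discrete_subspace D & iw X #<= D.
  apply: contrapT => nD; apply: niwT; apply: card_le_trans iwn _.
  apply: card_sup_le => D dD; have [//|TD] := card_le_total D [set: T].
  have niwD : ~ (iw X #<= D) by move=> iwD; apply: nD; exists D.
  have [Diw|//] := card_le_total D (iw X).
  have [DT|DS] : [set: D] #= [set: T] \/ [set: D] #= [set: set T].
  - apply: gch => //; first by rewrite (card_le_eqr (card_setT D)).
    by rewrite (card_le_eql (card_setT D)); exact: card_le_trans Diw iwT.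
  - by rewrite -(card_le_eql (card_setT D)) (card_le_eql DT).
  - case: niwD; rewrite -(card_le_eqr (card_setT D)) (card_le_eqr DS).
    exact: iwT.
apply: (separating_discrete_of_power R x0 tX dD _ iwD).
by move=> /(card_le_finite (card_le_trans Tiw iwD)).
Qed.
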